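(* Let $\kappa$ be an uncountable cardinal. If $\kappa \in \mathfrak{sp}(\text{Borel})$, then $\mathfrak{par}(\kappa^\omega) \in \mathfrak{sp}(\text{Borel})$.
   Context: $\mathfrak{sp}(\text{Borel}) = \{|\mathcal{P}| : \mathcal{P} \text{ is a partition of } \mathbb{R} \text{ into uncountably many Borel sets}\}$. The cardinal $\kappa$ has the discrete topology and $\kappa^\omega$ the product topology. For a topological space $X$, $\mathfrak{par}(X) = \min\{|\mathcal{P}| : \mathcal{P} \text{ is a partition of } X \text{ into Polish subspaces}\}$. *)

(* Defs.v *)
From HB Require Import structures.
From mathcomp Require Import all_boot all_order all_algebra.
From mathcomp Require Import all_classical all_reals all_analysis.

Set Implicit Arguments.
Unset Strict Implicit.
Unset Printing Implicit Defensive.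

Import Order.TTheory GRing.Theory Num.Theory.
Import numFieldNormedType.Exports.

Local Open Scope classical_set_scope.
Local Open Scope ring_scope.
Local Open Scope card_scope.

(* Cardinals are represented by sets, up to the equipotence [#=] and ordered by
   [#<=]. A partition is a set [P] of blocks (the library's indexed [partition]
   taken at the identity family), so that its cardinality is that of [P]. *)

(* [sp_Borel R A] reads |A| \in sp(Borel). *)
Definition sp_Borel (R : realType) (T : Type) (A : set T) : Prop :=
  exists P : set (set R),
    [/\ partition P id [set: R],
        P `<=` <<s @open R >>,
        ~ countable P
      & P #= A].

Definition is_metric (R : realType) (X : Type) (d : X -> X -> R) : Prop :=
  [/\ forall x y, d x y = 0 <-> x = y,
      forall x y, d x y = d y x
    & forall x y z, d x z <= d x y + d y z].

Definition metric_induces (R : realType) (X : topologicalType)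
    (d : X -> X -> R) : Prop :=
  forall U : set X, open U <->
    forall x, U x -> exists2 e : R, 0 < e & [set y | d x y < e] `<=` U.

Definition metric_cauchy_seq (R : realType) (X : Type) (d : X -> X -> R)
    (u : nat -> X) : Prop :=
  forall e : R, 0 < e ->
    exists N : nat, forall m n, (N <= m)%N -> (N <= n)%N -> d (u m) (u n) < e.

Definition metric_complete (R : realType) (X : Type) (d : X -> X -> R) : Prop :=
  forall u : nat -> X, metric_cauchy_seq d u ->
    exists x : X, forall e : R, 0 < e ->
      exists N : nat, forall n, (N <= n)%N -> d (u n) x < e.

Definition completely_metrizable (R : realType) (X : topologicalType) : Prop :=
  exists d : X -> X -> R, [/\ is_metric d, metric_induces d & metric_complete d].

Definition separable_space (X : topologicalType) : Prop :=
  exists2 D : set X, countable D & dense D.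

Definition polish_space (R : realType) (X : topologicalType) : Prop :=
  separable_space X /\ completely_metrizable R X.

(* The block [A] is coerced to the subtype of its elements, whose topology is
   the subspace topology (unlike the library's [subspace A]). *)
Definition polish_partition (R : realType) (X : topologicalType)
    (P : set (set X)) : Prop :=
  partition P id [set: X] /\ forall A : set X, P A -> polish_space R A.

Definition min_polish_partition (R : realType) (X : topologicalType)
    (P : set (set X)) : Prop :=
  polish_partition R P /\
  forall Q : set (set X), polish_partition R Q -> P #<= Q.

(* The cardinal par(X), represented by a chosen partition of least cardinality;
   [parP] shows that there is one. *)
Definition par (R : realType) (X : topologicalType) : set (set X) :=
  [get P | @min_polish_partition R X P].
Arguments par : clear implicits.

Lemma card_le_wf (T : pointedType) (S : set (set T)) :
  S !=set0 -> exists2 P, S P & forall Q, S Q -> P #<= Q.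
Proof.
move=> [Q0 SQ0].
pose Z := [set M : set (set T -> T) |
  (forall f Q, M f -> S Q -> Q (f Q)) /\
  (forall f g Q, M f -> M g -> S Q -> f Q = g Q -> f = g)].
have [|M [[ZM1 ZM2] Mmax]] := @Zorn_bigcup _ Z.
  move=> F FZ Ftot; split=> [f Q [M FM Mf] SQ|f g Q [M FM Mf] [N FN Ng] SQ fg].
    by have [FZ1 _] := FZ _ FM; exact: (FZ1 f Q Mf SQ).
  have [MN|NM] := Ftot _ _ FM FN.
    by have [_ FZ2] := FZ _ FN; exact: (FZ2 f g Q (MN _ Mf) Ng SQ fg).
  by have [_ FZ2] := FZ _ FM; exact: (FZ2 f g Q Mf (NM _ Ng) SQ fg).
have [[P SP PM]|noP] :=
    pselect (exists2 P, S P & P `<=` [set f P | f in M]).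
  exists P => // Q SQ.
  apply: (card_le_trans (subset_card_le PM)).
  apply: (card_le_trans (card_image_le _ _)).
  have inj : {in M &, injective (fun f : set T -> T => f Q)}.
    by move=> f g /set_mem Mf /set_mem Mg; exact: (ZM2 f g Q Mf Mg SQ).
  have := inj_card_eq inj; rewrite card_eq_sym => /card_eqPle[MQ _].
  apply: (card_le_trans MQ); apply: subset_card_le => _ [f Mf <-].
  exact: (ZM1 f Q Mf SQ).
have /choice[a aP] : forall Q, exists x, S Q -> Q x /\ ~ [set f Q | f in M] x.
  move=> Q; have [SQ|] := pselect (S Q); last by exists point.
  apply: contrapT => nx; apply: noP; exists Q => // x Qx.
  by apply: contrapT => nMx; apply: nx; exists x.
exfalso; apply: (Mmax (M `|` [set a])).
  split; first by move=> f Mf; left.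
  move=> /(_ a (or_intror erefl)) Ma.
  by have [_] := aP _ SQ0; apply; exists a.
split=> [f Q [Mf|->] SQ|f g Q [Mf|->] [Mg|->] SQ //].
- exact: (ZM1 f Q Mf SQ).
- by have [] := aP _ SQ.
- exact: (ZM2 f g Q Mf Mg SQ).
- by move=> fa; have [_] := aP _ SQ; case; exists f.
- by move=> ag; have [_] := aP _ SQ; case; exists g.
Qed.

Lemma polish_space_set1 (R : realType) (X : topologicalType) (x : X) :
  polish_space R [set x].
Proof.
have e (a b : [set x]) : a = b.
  apply: val_inj; case: a => a /= /set_mem; case: b => b /= /set_mem.
  by move=> -> ->.
split.
  exists [set: [set x]]; last by move=> O [y Oy] _; exists y.
  apply: finite_set_countable.
  exact: sub_finite_set (finite_set1 (exist _ x (mem_set erefl))).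
exists (fun _ _ => 0); split.
- by split=> // a b; rewrite addr0.
- move=> U; split=> [_ a Ua|_].
    by exists 1 => // b _; rewrite (e b a).
  have [[a Ua]|U0] := pselect (U !=set0).
    suff -> : U = setT by exact: openT.
    by apply/seteqP; split=> // b _; rewrite (e b a).
  suff -> : U = set0 by exact: open0.
  by apply/seteqP; split=> // b Ub; apply: U0; exists b.
- move=> u _; exists (u 0%N) => r r0.
  by exists 0%N.
Qed.

Lemma parP (R : realType) (X : topologicalType) :
  min_polish_partition R (par R X).
Proof.
apply: (@getPex _ (@min_polish_partition R X)).
have [|P pP Pmin] := @card_le_wf _ [set P | @polish_partition R X P].
  exists (range set1); split; last first.
    by move=> _ [x _ <-]; exact: polish_space_set1.
  split.
  - by apply/seteqP; split=> // x _; exists [set x].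
  - by move=> _ _ [x _ <-] [y _ <-] [_ [-> ->]].
  - by move=> _ [x _ <-]; exists x.
by exists P.
Qed.

(* Main.v *)
(* Let [f : R -> K] send a real to the index of its block. Composing [f],
   coordinatewise, with a Borel surjection [R -> R^nat] gives a surjection
   [psi : R -> K^nat] such that each [psi r n = k] is a Borel condition on [r].
   A Polish subspace of [K^nat] is a countable intersection of countable unions
   of cylinders (the cylinders centred in a countable dense set on which the
   complete metric oscillates little), so its preimage under [psi] is Borel, and
   the preimages of the blocks of a least Polish partition of [K^nat] partition
   [R]. There are uncountably many, since countably many separable subspaces
   only have countably many 0-th coordinates. *)
Require Import Defs.
From mathcomp Require Import all_boot all_order all_algebra.
From mathcomp Require Import all_classical all_reals all_analysis.
From mathcomp Require Import measurable_realfun ring lra.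

Set Implicit Arguments.
Unset Strict Implicit.
Unset Printing Implicit Defensive.

Import Order.TTheory GRing.Theory Num.Theory.
Import numFieldNormedType.Exports.

Local Open Scope classical_set_scope.
Local Open Scope ring_scope.
Local Open Scope card_scope.

Lemma preimage_inj (T U : Type) (f : T -> U) :
  range f = [set: U] -> injective (preimage f).
Proof.
by move=> fT A B AB; rewrite -(image_preimage A fT) AB image_preimage.
Qed.

Lemma partition_preimage (T U : Type) (f : T -> U) (P : set (set U)) :
  range f = [set: U] -> partition P id [set: U] ->
  partition (preimage f @` P) id [set: T].
Proof.
move=> fT [Pcover Ptriv Pneq0]; split.
- apply/seteqP; split=> // t _.
  have [A PA At] : cover P id (f t) by rewrite Pcover.
  by exists (f @^-1` A) => //; exists A.
- move=> _ _ [A PA <-] [B PB <-] [t [At Bt]].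
  by rewrite (Ptriv A B)//; exists (f t).
- move=> _ [A PA <-]; have [u Au] := Pneq0 A PA.
  have [t _ tu] : range f u by rewrite fT.
  by exists t; rewrite /= tu.
Qed.

Lemma partition_fibers (T K : Type) (P : set (set T)) :
  partition P id [set: T] -> P #= [set: K] ->
  exists2 f : T -> K, range f = [set: K] & forall k, P (f @^-1` [set k]).
Proof.
move=> [Pcover Ptriv Pneq0] /card_bijP[h [g hK gK]].
have /choice[B BP] : forall t, exists B : P, (\val B) t.
  move=> t; have [B PB Bt] : cover P id t by rewrite Pcover.
  by exists (exist _ B (mem_set PB)).
have B_unique (A : P) t : (\val A) t -> B t = A.
  move=> At; apply: val_inj; apply: Ptriv; [exact: set_valP..|].
  by exists t; split=> //; exact: BP.
pose f t := \val (h (B t)); pose block k := g (exist _ k (mem_set I)).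
have fiberE k : f @^-1` [set k] = \val (block k).
  apply/seteqP; split=> t /= => [ftk|/B_unique Bt].
    suff -> : block k = B t by exact: BP.
    by rewrite -(hK (B t)) /block; congr g; apply: val_inj; exact: esym ftk.
  by rewrite /f Bt gK.
have Pfiber k : P (f @^-1` [set k]) by rewrite fiberE; exact: set_valP.
exists f => //; apply/seteqP; split=> // k _.
by have [t ftk] := Pneq0 _ (Pfiber k); exists t.
Qed.

Lemma countable_bigcup_measurable d (T : sigmaRingType d) (I : Type)
    (D : set I) (F : I -> set T) :
  countable D -> (forall i, D i -> measurable (F i)) ->
  measurable (\bigcup_(i in D) F i).
Proof.
move=> Dcountable mF; rewrite bigcup_set_type.
apply: countable_bigcupT_measurable => [|i]; last exact/mF/set_valP.
by rewrite (eq_countable (card_setT D)).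
Qed.

Section borel_partition.
Variable R : realType.

Lemma sigma_openE : <<s @open R >> = @measurable _ R.
Proof.
apply/seteqP; split.
  apply: smallest_sub; first exact: sigma_algebra_measurable.
  by move=> U /open_measurable.
move=> A mA; have : (@RGenOpens.G R).-sigma.-measurable A.
  by rewrite -RGenOpens.measurableE.
apply: smallest_sub; first exact: smallest_sigma_algebra.
by move=> _ [x [y ->]]; apply: sub_sigma_algebra; exact: interval_open.
Qed.

Lemma sp_Borel_fibers (K : Type) :
  sp_Borel R [set: K] ->
  exists2 f : R -> K,
    range f = [set: K] & forall k, measurable (f @^-1` [set k]).
Proof.
move=> [P [Ppart + _ PK]]; rewrite sigma_openE => Pmeas.
have [f fT Pf] := partition_fibers Ppart PK.
by exists f => // k; exact: Pmeas.
Qed.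

Lemma sp_Borel_preimage (U : Type) (f : R -> U) (P : set (set U)) :
  range f = [set: U] -> partition P id [set: U] ->
  (forall A, P A -> measurable (f @^-1` A)) -> ~ countable P -> sp_Borel R P.
Proof.
move=> fT Ppart Pmeas Puncountable.
have card_preimage : preimage f @` P #= P.
  by apply: inj_card_eq => A B _ _; exact: preimage_inj.
exists (preimage f @` P); split => //.
- exact: partition_preimage.
- by rewrite sigma_openE => _ [A PA <-]; exact: Pmeas.
- by rewrite (eq_countable card_preimage).
Qed.

End borel_partition.

Fixpoint quaternary (b : nat -> bool) (k : nat) : nat :=
  if k is j.+1 then (4 * quaternary b j + b k)%N else b 0%N.

Lemma odd_quaternary (b : nat -> bool) (k : nat) : odd (quaternary b k) = b k.
Proof. by case: k => [|k]; rewrite ?oddb//= oddD oddM /= oddb. Qed.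

Section bits.
Context {R : realType}.
Implicit Types (r : R) (k : nat).

Lemma nested_itv_inter (lo hi : nat -> R) :
  nondecreasing_seq lo -> nonincreasing_seq hi -> (forall n, lo n <= hi n) ->
  exists x, forall n, lo n <= x <= hi n.
Proof.
move=> lo_nd hi_ni lo_hi.
have lo_le_hi m n : lo m <= hi n.
  rewrite (le_trans (lo_nd _ _ (leq_maxl m n)))//.
  by rewrite (le_trans (lo_hi _))//; exact: hi_ni (leq_maxr m n).
exists (sup (range lo)) => n; apply/andP; split.
  by apply: ub_le_sup; [exists (hi n) => _ [m _ <-]|exists n].
by apply: ge_sup; [exists (lo n); exists n|move=> _ [m _ <-]].
Qed.

Definition bit k r : bool := odd `|Num.floor (4 ^+ k * r)|%N.

Lemma bit_eq_odd k r (n : nat) :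
  n%:R <= 4 ^+ k * r < n.+1%:R -> bit k r = odd n.
Proof.
move=> n_itv; rewrite /bit (@floor_def _ _ n%:Z) ?absz_nat//.
by rewrite intrD -!pmulrn natr1.
Qed.

(* The number wanted is [\sum_j b j / 4 ^ j]. Its [k]-th remainder is at most
   [\sum_(j > k) 4 ^- j = 4 ^- k / 3], too little for a carry to reach the
   [k]-th digit, which is read off as a parity since the base is even. *)
Lemma bit_surj (b : nat -> bool) : exists r, forall k, bit k r = b k.
Proof.
pose lo k : R := (quaternary b k)%:R / 4 ^+ k.
pose hi k : R := ((quaternary b k)%:R + 1 / 3) / 4 ^+ k.
have pow4_gt0 k : (0 : R) < 4 ^+ k by rewrite exprn_gt0.
have lo_nd : nondecreasing_seq lo.
  apply/nondecreasing_seqP => k; rewrite -subr_ge0.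
  rewrite (_ : lo k.+1 - lo k = (b k.+1)%:R / 4 ^+ k.+1) ?divr_ge0//.
  by rewrite /lo /= natrD natrM exprS; field; rewrite gt_eqF.
have hi_ni : nonincreasing_seq hi.
  apply/nonincreasing_seqP => k; rewrite -subr_ge0.
  rewrite (_ : hi k - hi k.+1 = (1 - (b k.+1)%:R) / 4 ^+ k.+1).
    by rewrite divr_ge0// subr_ge0 lern1 leq_b1.
  by rewrite /hi /= natrD natrM exprS; field; rewrite gt_eqF.
have lo_hi k : lo k <= hi k by rewrite ler_pM2r ?invr_gt0// lerDl; lra.
have [r r_itv] := nested_itv_inter lo_nd hi_ni lo_hi.
exists r => k; rewrite -(odd_quaternary b k); apply: bit_eq_odd.
move: (r_itv k); rewrite ler_pdivrMr// ler_pdivlMr// mulrC => /andP[-> /=].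
by rewrite -natr1; lra.
Qed.

Lemma measurable_bit k : measurable_fun [set: R] (bit k).
Proof.
apply: (measurable_fun_bool true); rewrite setTI.
rewrite (_ : _ @^-1` _ = \bigcup_(z in [set z : int | odd `|z|])
    *%R (4 ^+ k) @^-1` `[z%:~R, (z + 1)%:~R[); last first.
  apply/seteqP; split=> [r rk|r [z /= oz]].
    by exists (Num.floor (4 ^+ k * r)) => //=; rewrite in_itv /= floor_itv.
  by rewrite in_itv /= => /floor_def zr; rewrite /bit zr.
apply: countable_bigcup_measurable => // z _.
by rewrite -[X in measurable X]setTI; exact: mulrl_measurable.
Qed.

Definition cut_sup (b : rat -> bool) : R :=
  fine (ereal_sup [set (ratr q)%:E | q in [set q | b q]]).

Lemma cut_supK (x : R) : cut_sup (fun q => ratr q < x) = x.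
Proof.
rewrite /cut_sup (_ : ereal_sup _ = x%:E)//.
apply/eqP; rewrite eq_le; apply/andP; split.
  by apply: ge_ereal_sup => _ [q qx <-]; rewrite lee_fin ltW.
apply/lee_subgt0Pr => e e0; rewrite -EFinB.
have /rat_in_itvoo[q] : x - e < x by rewrite ltrBlDr ltrDl.
rewrite in_itv /= => /andP[xeq qx].
by apply: le_ereal_sup_tmp; exists (ratr q)%:E; [exists q|rewrite lee_fin ltW].
Qed.

Lemma measurable_cut_sup d (T : measurableType d) (b : T -> rat -> bool) :
  (forall q, measurable_fun [set: T] (b ^~ q)) ->
  measurable_fun [set: T] (fun t => cut_sup (b t)).
Proof.
move=> mb; apply: measurableT_comp; first exact: fine_measurable.
move=> _; apply: (measurability _ (ErealGenOInfty.measurableE R)) => //.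
move=> _ [_ [x ->] <-]; rewrite setTI.
rewrite (_ : _ @^-1` _ = \bigcup_(q in [set q | x < ratr q]) [set t | b t q]).
  apply: countable_bigcup_measurable => // q _.
  by rewrite -[X in measurable X]setTI; exact: mb.
apply/seteqP; split=> t /=; rewrite in_itv /= andbT.
  by move=> /ereal_sup_gtP[_ [q btq <-]]; rewrite lte_fin; exists q.
by move=> [q xq btq]; apply/ereal_sup_gtP; exists (ratr q)%:E => //; exists q.
Qed.

Definition decode_seq r (n : nat) : R :=
  cut_sup (fun q => bit (pickle (n, q)) r).

Lemma range_decode_seq : range decode_seq = [set: nat -> R].
Proof.
apply/seteqP; split=> // x _.
pose b m := if unpickle m is Some (n, q) then ratr q < x n else false.
have [r rb] := bit_surj b; exists r => //; apply/funext => n.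
rewrite -[RHS]cut_supK; congr cut_sup; apply/funext => q.
by rewrite rb /b pickleK.
Qed.

Lemma measurable_decode_seq (n : nat) :
  measurable_fun [set: R] (decode_seq ^~ n).
Proof. by apply: measurable_cut_sup => q; exact: measurable_bit. Qed.

Lemma sequence_surj (K : Type) (f : R -> K) :
  range f = [set: K] -> (forall k : K, measurable (f @^-1` [set k])) ->
  exists2 g : R -> nat -> K,
    range g = [set: nat -> K] &
    forall n (k : K), measurable [set r | g r n = k].
Proof.
move=> fT mf; exists (fun r => f \o decode_seq r) => [|n k].
  apply/seteqP; split=> // x _.
  have /choice[s fs] : forall n, exists s, f s = x n.
    by move=> n; have [s _ fs] : range f (x n); [rewrite fT|exists s].
  have [r _ rs] : range decode_seq s by rewrite range_decode_seq.
  by exists r => //; apply/funext => n; rewrite /= rs.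
rewrite -[X in measurable X]setTI.
exact: (measurable_decode_seq n measurableT (mf k)).
Qed.

End bits.

Section cylinders.
Context {K : nat -> discreteTopologicalType}.
Implicit Types (x y : prod_topology K) (m n : nat) (A : set (prod_topology K)).

Definition cylinder x m : set (prod_topology K) :=
  [set y | forall i, (i < m)%N -> y i = x i].

Lemma subset_cylinder x m n : (m <= n)%N -> cylinder x n `<=` cylinder x m.
Proof. by move=> mn y yx i im; apply: yx; exact: leq_trans mn. Qed.

Lemma cylinder_eq x y m : cylinder x m y -> cylinder y m = cylinder x m.
Proof. by move=> xy; apply/seteqP; split=> z h i im; rewrite h// xy. Qed.

Lemma cylinder_open x m : open (cylinder x m).
Proof.
elim: m => [|m IHm].
  rewrite (_ : cylinder x 0 = setT); first exact: openT.
  by apply/seteqP; split.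
rewrite (_ : cylinder x m.+1 = cylinder x m `&` proj m @^-1` [set x m]).
  apply: openI => //; apply: open_comp; last exact: discrete_open.
  by move=> y _; exact: proj_continuous.
apply/seteqP; split=> [y yx|y [yx ym] i].
  by split; [move=> i im; exact/yx/ltnW|exact: yx].
by rewrite ltnS leq_eqVlt => /predU1P[->//|/yx].
Qed.

Lemma nbhs_cylinderP x A : nbhs x A <-> exists m, cylinder x m `<=` A.
Proof.
split=> [xA|[m /filterS]]; last first.
  by apply; apply: open_nbhs_nbhs; split => //; exact: cylinder_open.
pose F := filter_from [set: nat] (cylinder x).
have F_filter : Filter F.
  apply: filter_from_filter; first by exists 0%N.
  move=> m n _ _; exists (maxn m n) => // y yx.
  by split; apply: subset_cylinder yx; rewrite ?leq_maxl ?leq_maxr.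
have : F --> x.
  apply/cvg_sup => i V [_ [[W _ <-] Wx WV]].
  by exists i.+1 => // y yx; apply: WV => /=; rewrite yx.
by move=> /(_ A xA)[m _ mA]; exists m.
Qed.

Lemma measurable_preimage_cylinder d (T : measurableType d)
    (f : T -> prod_topology K) x m :
  (forall n k, measurable [set t | f t n = k]) ->
  measurable (f @^-1` cylinder x m).
Proof.
move=> mf; rewrite (_ : _ @^-1` _ =
  \bigcap_(i in [set i | (i < m)%N]) [set t | f t i = x i])//.
by apply: bigcap_measurableType => i _; exact: mf.
Qed.

Lemma subspace_cylinder_open A x m : open [set y : A | cylinder x m (\val y)].
Proof. by exists (cylinder x m) => //; exact: cylinder_open. Qed.

Lemma subspace_open_cylinder A (U : set A) (a : A) :
  open U -> U a -> exists m, (\val : A -> _) @^-1` cylinder (\val a) m `<=` U.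
Proof.
move=> [V oV <-] Va.
have [|m mV] := (nbhs_cylinderP (\val a) V).1; first exact: open_nbhs_nbhs.
by exists m => y /mV.
Qed.

End cylinders.

Lemma metric_ball_open (R : realType) (X : topologicalType) (d : X -> X -> R)
    (x : X) (e : R) :
  is_metric d -> metric_induces d -> open [set y | d x y < e].
Proof.
move=> [_ _ triangle] dX; apply/dX => y /= xy.
exists (e - d x y); rewrite ?subr_gt0// => z /=.
by rewrite ltrBrDl; exact: le_lt_trans.
Qed.

Section complete_subspace.
Context {R : realType} {K : nat -> discreteTopologicalType}.
Context {A : set (prod_topology K)} {d : A -> A -> R}.
Hypotheses (d_metric : is_metric d) (d_induces : metric_induces d).

(* Letting [n <= m] forces a point lying in a small cylinder for each [n] to be
   adherent to [A], since the centre [y] belongs to [A]. *)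
Definition small_cylinder (n : nat) (y : A) (m : nat) : Prop :=
  (n <= m)%N /\ forall z w : A, cylinder (\val y) m (\val z) ->
    cylinder (\val y) m (\val w) -> d z w < n.+1%:R^-1.

Lemma in_small_cylinder (D : set A) (n : nat) (a : A) : dense D ->
  exists y m, [/\ D y, small_cylinder n y m & cylinder (\val y) m (\val a)].
Proof.
have [d0 dC triangle] := d_metric; move=> Ddense.
pose e : R := n.+1%:R^-1 / 2; have e_gt0 : 0 < e by rewrite divr_gt0.
have aa_lt_e : d a a < e by rewrite (d0 a a).2.
have [m0 m0e] :=
  subspace_open_cylinder (metric_ball_open a e d_metric d_induces) aa_lt_e.
pose m := maxn m0 n.
have [||y [/= ay Dy]] := Ddense [set y : A | cylinder (\val a) m (\val y)].
- by exists a.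
- exact: subspace_cylinder_open.
have near_a z : cylinder (\val y) m (\val z) -> d a z < e.
  rewrite (cylinder_eq ay) => az; apply: m0e.
  by apply: subset_cylinder az; exact: leq_maxl.
exists y, m; split=> //; last by rewrite (cylinder_eq ay).
split=> [|z w /near_a az /near_a aw]; first exact: leq_maxr.
by rewrite (le_lt_trans (triangle z a w))// (dC z a) [ltRHS]splitr ltrD.
Qed.

Lemma cylinder_limit_unique (x : prod_topology K) (u : nat -> A) (a : A) :
  (forall m, cylinder x m (\val (u m))) ->
  (forall e : R, 0 < e -> exists N, forall n, (N <= n)%N -> d (u n) a < e) ->
  x = \val a.
Proof.
move=> ux ua; apply: functional_extensionality_dep => i.
have [_ dC _] := d_metric.
have [e e_gt0 ball_a] :=
  (d_induces _).1 (subspace_cylinder_open A (\val a) i.+1) a (fun _ _ => erefl).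
have [N uN] := ua e e_gt0; pose n := maxn N i.+1.
have un_a : cylinder (\val a) i.+1 (\val (u n)).
  by apply: (ball_a (u n)); rewrite /= dC uN// leq_maxl.
by rewrite -(un_a i)// (ux n)// leq_maxr.
Qed.

Lemma small_cylinders_complete (x : prod_topology K) : metric_complete d ->
  (forall n, exists y m, small_cylinder n y m /\ cylinder (\val y) m x) -> A x.
Proof.
move=> d_complete x_small.
have /choice[u ux] : forall m, exists a : A, cylinder x m (\val a).
  move=> m; have [y [k [[mk _] yx]]] := x_small m.
  by exists y => i im; rewrite yx//; exact: leq_trans mk.
have u_cauchy : metric_cauchy_seq d u.
  move=> e e_gt0; have [y [k [[_ yk_small] yx]]] := x_small (Num.truncn e^-1).
  have near_y p : (k <= p)%N -> cylinder (\val y) k (\val (u p)).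
    by move=> kp; rewrite -(cylinder_eq yx); exact: subset_cylinder (ux p).
  exists k => p q kp kq.
  rewrite (lt_trans (yk_small _ _ (near_y p kp) (near_y q kq)))//.
  by rewrite invf_plt ?posrE//; exact: truncnS_gt.
have [a ua] := d_complete _ u_cauchy.
by rewrite (cylinder_limit_unique ux ua); exact: set_valP.
Qed.

Lemma complete_subspace_Gdelta (D : set A) : metric_complete d -> dense D ->
  A = \bigcap_n \bigcup_(p in [set p | D p.1 /\ small_cylinder n p.1 p.2])
        cylinder (\val p.1) p.2.
Proof.
move=> d_complete Ddense; apply/seteqP; split=> [x Ax n _|x xG].
  have [y [m [Dy ym yx]]] :=
    in_small_cylinder n (exist _ x (mem_set Ax)) Ddense.
  by exists (y, m).
apply: small_cylinders_complete => // n.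
by have [[y m] [_ ym] yx] := xG n I; exists y, m.
Qed.

End complete_subspace.

Lemma measurable_preimage_polish (R : realType)
    (K : nat -> discreteTopologicalType) d (T : measurableType d)
    (f : T -> prod_topology K) (A : set (prod_topology K)) :
  (forall n k, measurable [set t | f t n = k]) ->
  polish_space R A -> measurable (f @^-1` A).
Proof.
move=> mf [[D Dcountable Ddense] [dist [d_metric d_induces d_complete]]].
rewrite (complete_subspace_Gdelta d_metric d_induces d_complete Ddense).
rewrite preimage_bigcap; apply: bigcap_measurableType => n _.
rewrite preimage_bigcup; apply: countable_bigcup_measurable => [|p _].
  apply: sub_countable (countableX Dcountable (countableP [set: nat])).
  by apply: subset_card_le => -[y m] [/= Dy _].
exact: measurable_preimage_cylinder.
Qed.

Lemma separable_image_countable (X : topologicalType)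
    (K : discreteTopologicalType) (f : X -> K) :
  continuous f -> separable_space X -> countable (range f).
Proof.
move=> f_cont [D Dcountable Ddense].
apply: (sub_countable _ Dcountable); apply: card_le_trans (card_image_le f D).
apply: subset_card_le => _ [x _ <-].
have [||y [/= fyx Dy]] := Ddense (f @^-1` [set f x]); last by exists y.
- by exists x.
- by apply: open_comp => [y _|]; [exact: f_cont|exact: discrete_open].
Qed.

Lemma separable_cover_countable (X : topologicalType)
    (K : discreteTopologicalType) (f : X -> K) (P : set (set X)) :
  continuous f -> cover P id = [set: X] ->
  (forall A : set X, P A -> separable_space A) -> countable P ->
  countable (range f).
Proof.
move=> f_cont Pcover Psep Pcountable; rewrite -Pcover /cover image_bigcup.
apply: bigcup_countable => // A PA.
suff -> : f @` A = range (fun a : A => f (\val a)).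
  apply: separable_image_countable (Psep A PA) => a.
  by apply: continuous_comp; [exact: initial_continuous|exact: f_cont].
apply/seteqP; split=> [_ [a Aa <-]|_ [a _ <-]].
  by exists (exist _ a (mem_set Aa)).
by exists (\val a) => //; exact: set_valP.
Qed.

Lemma separable_cover_uncountable (I : eqType) (i : I) (K : choiceType)
    (P : set (set (prod_topology (fun _ : I => discrete_topology K)))) :
  ~ countable [set: K] -> cover P id = setT ->
  (forall A : set _, P A -> separable_space A) -> ~ countable P.
Proof.
move=> Kuncountable Pcover Psep Pcountable; apply: Kuncountable.
pose coord : prod_topology (fun _ : I => discrete_topology K) ->
  discrete_topology K := proj i.
have <- : range coord = [set: K].
  by apply/seteqP; split=> // k _; exists (fun=> k).
have coord_cont : continuous coord by exact: proj_continuous.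
exact: separable_cover_countable coord_cont Pcover Psep Pcountable.
Qed.

Theorem theorem4p3 (R : realType) (K : choiceType) :
  ~ countable [set: K] ->
  sp_Borel R [set: K] ->
  sp_Borel R (par R (prod_topology (fun _ : nat => discrete_topology K))).
Proof.
move=> Kuncountable /sp_Borel_fibers[f fT mf].
have [psi psiT mpsi] := sequence_surj fT mf.
set X := prod_topology _; have [[Ppart Ppolish] _] := parP R X.
apply: (sp_Borel_preimage psiT Ppart) => [A /Ppolish|].
  exact: measurable_preimage_polish.
have [Pcover _ _] := Ppart.
by apply: (separable_cover_uncountable 0%N Kuncountable Pcover) => A /Ppolish[].
Qed.
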